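(* Let $\delta>0$ be fixed, and let $N,H,Q,q\in\mathbb{N}$ be such that $Q<q\le 2Q$, $H=o(q)$, $q=o(N)$ and $Q>\sqrt{N^{1+\delta}H}$. Define $g:\mathbb{N}\to\{-1,0,1\}$ by $$ g(d)=\mathrm{sgn}\left(\sum_{1\le a\le H}\left(\sum_{\substack{N/d<m\le 2N/d\\ md\equiv a\ (\mathrm{mod}\ q)}}1-\frac1q\sum_{N/d<m\le 2N/d}1\right)\right)\quad\text{if } Q<d\le 2Q, $$ and $g(d)=0$ otherwise. Let $f(n)=\sum_{d\mid n}g(d)$, which is a sieve function of range $2Q$. Then $$ \left|\ \sum_{1\le a\le H}\ \sum_{\substack{N<n\le 2N\\ n\equiv a\ (\mathrm{mod}\ q)}} f(n)\;-\;\frac{H}{q}\sum_{N<n\le 2N} f(n)\ \right|\ \gg\ \frac{NH}{q}. $$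
   Context: The sums over $m$ and $n$ run over integers. The sign function is $\mathrm{sgn}(x)=x/|x|$ for $x\in\mathbb{R}\setminus\{0\}$ and $\mathrm{sgn}(0)=0$. Sieve functions: an arithmetic function $f:\mathbb{N}\to\mathbb{R}$ is called a sieve function of range $R$ (with $R\in\mathbb{N}$) if its Eratosthenes transform $g=f\ast\mu$ (Dirichlet convolution with the Möbius function) vanishes outside $[1,R]$ and satisfies $g(d)\ll_{\varepsilon} d^{\varepsilon}$ for all $\varepsilon>0$. Asymptotic conventions: the parameters $q,H,Q$ vary with $N$, where $N\to\infty$; $H=o(q)$ and $q=o(N)$ mean $H/q\to0$ and $q/N\to0$. $A\gg B$ means $A\ge cB$ for some constant $c>0$ independent of $N,H,Q,q$, for all sufficiently large $N$ (how large may depend on $\delta$ and on the rates in the $o(\cdot)$ conditions). *)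

(* Defs.v *)
From HB Require Import structures.
From mathcomp Require Export all_boot all_order all_algebra.
From mathcomp Require Export all_classical all_reals all_analysis.
Export Order.TTheory GRing.Theory Num.Theory.
Export numFieldNormedType.Exports.

Set Implicit Arguments.
Unset Strict Implicit.
Unset Printing Implicit Defensive.

Local Open Scope classical_set_scope.
Local Open Scope ring_scope.

(* Arithmetic functions are functions nat -> R whose value at 0 is irrelevant:
   [divisors 0] is empty, and only positive arguments are ever used. *)

Definition dirichlet_conv (R : realType) (f g : nat -> R) (n : nat) : R :=
  \sum_(d <- divisors n) f d * g (n %/ d)%N.

Definition moebius (R : realType) (n : nat) : R :=
  if all (fun p => logn p n == 1%N) (primes n)
  then (-1) ^+ size (primes n) else 0.

Definition eratosthenes (R : realType) (f : nat -> R) : nat -> R :=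
  dirichlet_conv f (@moebius R).

(* [K eps] is the implied constant in g(d) <<_eps d^eps.  For a single f the
   bound holds with some K as soon as the transform has finite support, so K is
   a parameter: this lets one K serve a whole family of functions whose range
   grows. *)
Definition sieve_function (R : realType) (K : R -> R) (range : nat)
    (f : nat -> R) : Prop :=
  (forall d : nat, ~~ (1 <= d <= range)%N -> eratosthenes f d = 0) /\
  (forall eps : R, 0 < eps -> forall d : nat, (0 < d)%N ->
     `|eratosthenes f d| <= K eps * d%:R `^ eps).

(* N/d < m <= 2N/d, with real (not Euclidean) quotients *)
Definition in_dyadic (R : realType) (N d m : nat) : bool :=
  ((N%:R / d%:R : R) < m%:R) && (m%:R <= ((2 * N)%:R / d%:R : R)).

(* For d > 0, every integer m with N/d < m <= 2N/d lies in [0, 2N], so letting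
   m run over 'I_(2N+1) loses nothing. *)
Definition disc (R : realType) (N H q d : nat) : R :=
  \sum_(1 <= a < H.+1)
    (\sum_(m < (2 * N).+1 | in_dyadic R N d m && (m * d == a %[mod q])%N) 1
     - q%:R^-1 * \sum_(m < (2 * N).+1 | in_dyadic R N d m) 1).

Definition gfun (R : realType) (N H Q q d : nat) : R :=
  if (Q < d <= 2 * Q)%N then Num.sg (disc R N H q d) else 0.

Definition fsieve (R : realType) (N H Q q n : nat) : R :=
  \sum_(d <- divisors n) gfun R N H Q q d.

(* Main.v *)
(* Expanding [f] over its divisors [d] and exchanging the sums, the quantity to be
   bounded is exactly [\sum_(Q < d <= 2Q) `|disc d|], because [g d] is the sign of
   [disc d].  If no [m] in [(N/d, 2N/d]] has [m * d] congruent to some [a] in [1, H]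
   modulo [q], then [`|disc d|] is [H / q] times the number of integers in
   [(N/d, 2N/d]], hence at least [(H / q) * (N / 4Q)].  The number of pairs [(d, m)]
   that do meet such a residue class is at most the sum of the divisor function over
   at most [3NH / q] integers up to [2N], so by the divisor bound and
   [Q ^ 2 > N ^ (1 + delta) * H] it is at most [Q / 2]. *)
Require Import Defs.
From mathcomp Require Import zify ring lra.

Local Open Scope classical_set_scope.
Local Open Scope ring_scope.

(** * The divisor bound *)

Section DivisorBound.
Local Open Scope nat_scope.

(** For a prime [p] of exponent [e], [divisors] runs [e] rounds, each adding as many entries as the
    list [divs] it started from. *)
Lemma size_divisors (n : nat) :
  size (divisors n) = \prod_(f <- prime_decomp n) f.2.+1.
Proof.
rewrite /divisors; elim: (prime_decomp n) => [|[p e] s IHs]; first by rewrite big_nil.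
rewrite big_cons /= -{}IHs; set divs := foldr _ _ _.
elim: e => [|e IHe] /=; first by rewrite mul1n.
by rewrite size_merge size_cat size_map IHe mulSn addnC.
Qed.

(* Through [(a + 1) ... (a + k) = k! 'C(a + k, k)] and ['C(a + k, k) <= 2 ^ (a + k)]. *)
Lemma expS_le_exp2 (k a : nat) : a.+1 ^ k <= k`! * 2 ^ k * 2 ^ a.
Proof.
have rise : a.+1 ^ k <= (a + k) ^_ k.
  elim: k => [|k IHk]; first by rewrite expn0 ffactn0.
  rewrite addnS ffactnSr expnSr.
  have -> : (a + k).+1 - k = a.+1 by lia.
  rewrite leq_mul2r (leq_trans IHk) ?orbT //.
  (* What remains is that [b ^_ j] grows with [b]. *)
  elim: {+}k (a + k) => // j IHj b; rewrite !ffactnSr leq_mul //; lia.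
apply: leq_trans rise _.
rewrite -bin_ffact mulnC -mulnA leq_mul2l -expnD addnC; apply/orP; right.
have := expnDn 1 1 (k + a); rewrite addnn => ->.
have kle : k < (k + a).+1 by lia.
rewrite (bigD1 (Ordinal kle)) //= !exp1n !muln1; exact: leq_addr.
Qed.

Lemma leq_expn2r (m n e : nat) : m <= n -> m ^ e <= n ^ e.
Proof. by case: e => // e; rewrite leq_exp2r. Qed.

(** Both sides are compared prime by prime. With [e] the exponent of [p] in [n], a prime
    [p >= 2 ^ k] gives [e.+1 ^ k <= 2 ^ (e * k) <= p ^ e]; each of the at most [2 ^ k] smaller
    primes costs a factor [M], whence the constant [M ^ (2 ^ k)]. *)
Lemma divisor_bound (k : nat) :
  exists2 C, 0 < C & forall n, 0 < n -> size (divisors n) ^ k <= C * n.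
Proof.
pose M := k`! * 2 ^ k.
have M_gt0 : 0 < M by rewrite muln_gt0 fact_gt0 expn_gt0.
pose c p := if p < 2 ^ k then M else 1.
exists (M ^ (2 ^ k)) => [|n n_gt0]; first by rewrite expn_gt0 M_gt0.
have local_bound p : prime p -> (logn p n).+1 ^ k <= c p * p ^ logn p n.
  move=> /prime_gt1 p_gt1; rewrite /c; case: ltnP => [_|p_big].
    apply: leq_trans (expS_le_exp2 k _) _.
    by rewrite leq_mul2l leq_expn2r ?orbT.
  rewrite mul1n; apply: (@leq_trans ((2 ^ k) ^ logn p n)); last exact: leq_expn2r.
  by rewrite -expnM mulnC expnM leq_expn2r // ltn_expl.
have size_small : size [seq p <- primes n | p < 2 ^ k] <= 2 ^ k.
  rewrite -[X in _ <= X](size_iota 0); apply: uniq_leq_size.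
    by rewrite filter_uniq ?primes_uniq.
  by move=> p; rewrite mem_filter mem_iota => /andP[].
have -> : size (divisors n) ^ k = \prod_(p <- primes n) (logn p n).+1 ^ k.
  rewrite size_divisors prime_decompE big_map /=.
  by elim/big_ind2: _ => [|_ x _ y <- <-|//]; rewrite ?exp1n ?expnMn.
rewrite {3}(prod_prime_decomp n_gt0) prime_decompE big_map /=.
apply: (@leq_trans (\prod_(p <- primes n) (c p * p ^ logn p n))).
  rewrite !big_seq; elim/big_ind2: _ => [//|? ? ? ?|p]; first exact: leq_mul.
  by rewrite mem_primes => /andP[/local_bound].
rewrite big_split leq_mul2r; apply/orP; right.
rewrite /c -big_mkcond /= big_const_seq -size_filter iter_muln_1.
by rewrite leq_pexp2l.
Qed.
End DivisorBound.

(** * Moebius inversion *)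

Section Moebius.
Variable R : realType.
Local Notation mu := (@moebius R).

(** If [p] divides [d], its exponent in [p * d] is at least 2. Otherwise [p * d] has the primes of
    [d] with the same exponents and one new prime, which flips the sign. *)
Lemma moebius_primeM (p d : nat) : prime p -> (0 < d)%N ->
  mu (p * d)%N = if (p %| d)%N then 0 else - mu d.
Proof.
move=> p_pr d_gt0; rewrite /moebius.
have p_gt0 := prime_gt0 p_pr.
case: (boolP (p %| d)%N) => pd.
  case: ifP => // /allP all1; have := all1 p.
  rewrite mem_primes p_pr muln_gt0 p_gt0 d_gt0 dvdn_mulr // => /(_ isT).
  rewrite lognM // logn_prime // eqxx add1n eqSS.
  by rewrite -leqn0 leqNgt logn_gt0 mem_primes p_pr d_gt0 pd.
have p_notin : p \notin primes d by rewrite mem_primes p_pr d_gt0.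
have perm_pd : perm_eq (primes (p * d)) (p :: primes d).
  apply: uniq_perm => [||r]; rewrite ?primes_uniq //= ?p_notin ?primes_uniq //.
  by rewrite primesM // primes_prime // !inE.
rewrite (perm_all _ perm_pd) (perm_size perm_pd) /= exprS mulN1r.
have logp0 : logn p d = 0%N.
  by apply/eqP; rewrite -leqn0 leqNgt logn_gt0.
rewrite lognM // logn_prime // eqxx logp0 eqxx /=.
have -> : all (fun r => logn r (p * d) == 1%N) (primes d) =
          all (fun r => logn r d == 1%N) (primes d).
  apply: eq_in_all => r r_d; rewrite lognM // logn_prime //.
  by case: (eqVneq r p) => // rp; move: p_notin; rewrite -rp r_d.
by case: ifP => _; rewrite ?oppr0.
Qed.

(** Puts sums over the divisors of different integers on one common range, where they are compared
    through their predicates alone. *)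
Lemma big_divisors (n m : nat) (P : pred nat) (F : nat -> R) : (0 < n <= m)%N ->
  \sum_(d <- divisors n | P d) F d = \sum_(0 <= d < m.+1 | (d %| n)%N && P d) F d.
Proof.
move=> /andP[n_gt0 n_le]; rewrite -big_filter -[RHS]big_filter; apply: perm_big.
apply: uniq_perm => [||d]; rewrite ?filter_uniq ?divisors_uniq ?iota_uniq //.
rewrite !mem_filter -dvdn_divisors // mem_index_iota /= andbC.
case: (boolP (d %| n)%N) => //= /(dvdn_leq n_gt0) d_le; rewrite ltnS.
by rewrite (leq_trans d_le n_le) andbT.
Qed.

(* With [p] a prime factor of [n], the divisors [d] prime to [p] cancel against the
   divisors [p * d]; those divisible by [p ^ 2] do not contribute. *)
Lemma sum_moebius (n : nat) : (0 < n)%N ->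
  \sum_(d <- divisors n) mu d = (n == 1%N)%:R.
Proof.
move=> n_gt0; case: (ltngtP n 1) => [|n_gt1|->]; first by rewrite ltnNge n_gt0.
  pose p := pdiv n; have p_pr : prime p by exact: pdiv_prime.
  have p_gt0 := prime_gt0 p_pr.
  have [m n_pm] : exists m, n = (p * m)%N.
    by have /dvdnP[m ->] := pdiv_dvd n; exists m; rewrite mulnC.
  have m_gt0 : (0 < m)%N by move: n_gt0; rewrite n_pm muln_gt0 => /andP[].
  rewrite (bigID (fun d => p %| d)%N) /=.
  rewrite -[X in X + _]big_filter (perm_big [seq (p * d)%N | d <- divisors m]).
    rewrite big_map big_seq_cond (eq_bigr (fun d => if (p %| d)%N then 0 else - mu d)); last first.
      move=> d; rewrite andbT -dvdn_divisors // => d_m.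
      by rewrite moebius_primeM // (dvdn_gt0 m_gt0).
    rewrite -big_seq_cond (bigID (fun d => p %| d)%N) /= big1 ?add0r; last by move=> d ->.
    rewrite (eq_bigr (fun d => - mu d)); last by move=> d /negPf ->.
    rewrite sumrN addrC; apply/eqP; rewrite subr_eq0; apply/eqP.
    rewrite !(@big_divisors _ n) ?n_gt0 ?m_gt0 ?leqnn //; last first.
      by rewrite n_pm leq_pmull.
    (* For [d] prime to [p], dividing [p * m] is the same as dividing [m]. *)
    apply: eq_bigl => d; case: (boolP (p %| d)%N) => //= pd; first by rewrite !andbF.
    by rewrite !andbT n_pm Gauss_dvdr // coprime_sym prime_coprime.
  apply: uniq_perm => [||d]; first by rewrite filter_uniq ?divisors_uniq.
    rewrite map_inj_uniq ?divisors_uniq // => x y /eqP.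
    by rewrite eqn_pmul2l // => /eqP.
  rewrite mem_filter -dvdn_divisors //; apply/andP/mapP.
    move=> [/dvdnP[e ->]]; rewrite n_pm mulnC dvdn_pmul2l // => em.
    by exists e => //; rewrite -dvdn_divisors.
  move=> [e]; rewrite -dvdn_divisors // => em ->.
  by rewrite dvdn_mulr // n_pm dvdn_pmul2l.
by rewrite /divisors /= big_seq1 /moebius /= expr0.
Qed.

(** After exchanging the sums over [e %| d] and [d %| n], the coefficient of [g e] is the sum of
    [mu] over the divisors of [n %/ e], which is 1 for [e = n] and 0 otherwise. *)
Lemma eratosthenes_sum (g : nat -> R) (n : nat) : (0 < n)%N ->
  eratosthenes (fun m => \sum_(d <- divisors m) g d) n = g n.
Proof.
move=> n_gt0; rewrite /eratosthenes /dirichlet_conv.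
rewrite (eq_big_seq (fun d => \sum_(e <- divisors n | (e %| d)%N) g e * mu (n %/ d)%N)); last first.
  move=> d; rewrite -dvdn_divisors // => d_n; rewrite mulr_suml.
  have d_gt0 := dvdn_gt0 n_gt0 d_n.
  rewrite !(@big_divisors _ n) ?n_gt0 ?leqnn ?d_gt0 ?(dvdn_leq n_gt0) //.
  apply: eq_bigl => e; rewrite andbT; case: (boolP (e %| d)%N) => ed; last by rewrite andbF.
  by rewrite (dvdn_trans ed d_n).
rewrite (exchange_big_dep predT) //= big_seq.
rewrite (eq_bigr (fun e => g e * (e == n)%:R)).
  rewrite -big_seq (bigD1_seq n) ?divisors_uniq -?dvdn_divisors //= eqxx mulr1.
  by rewrite big1 ?addr0 // => e /negPf ->; rewrite mulr0.
move=> e; rewrite -dvdn_divisors // => e_n; rewrite -mulr_sumr; congr (_ * _).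
have e_gt0 := dvdn_gt0 n_gt0 e_n.
have ne_gt0 : (0 < n %/ e)%N by rewrite divn_gt0 // dvdn_leq.
have -> : (e == n) = (n %/ e == 1)%N.
  by rewrite [RHS]eq_sym eqn_div // mul1n.
rewrite -sum_moebius // -big_filter.
have k_n (k : nat) : (k %| n %/ e)%N -> (k %| n)%N.
  by move=> k_ne; apply: dvdn_trans k_ne (dvdn_div e_n).
(* The multiples [d] of [e] dividing [n] are the [n %/ k] with [k] dividing [n %/ e]. *)
rewrite (perm_big [seq (n %/ k)%N | k <- divisors (n %/ e)]).
  rewrite big_map; apply: eq_big_seq => k; rewrite -dvdn_divisors // => /k_n k_n'.
  by rewrite divnA // mulKn.
apply: uniq_perm => [||d]; first by rewrite filter_uniq ?divisors_uniq.
  rewrite map_inj_in_uniq ?divisors_uniq // => x y.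
  rewrite -!dvdn_divisors // => /k_n x_n /k_n y_n exy.
  by rewrite -(mulKn x n_gt0) -divnA // exy divnA // mulKn.
rewrite mem_filter -dvdn_divisors //; apply/andP/mapP => [[e_d d_n]|[k]].
  exists (n %/ d)%N; last by rewrite divnA // mulKn.
  by rewrite -dvdn_divisors // dvdn_divRL // -[X in (_ %| X)%N](divnK d_n) dvdn_mul.
rewrite -dvdn_divisors // => k_ne ->; split; last exact: dvdn_div (k_n _ k_ne).
by rewrite dvdn_divRL ?(k_n _ k_ne) // mulnC -(dvdn_divRL _ e_n).
Qed.
End Moebius.

(** * Counting multiples in residue classes, and the lower bound for the discrepancy *)

Section Discrepancy.
Variable R : realType.

Lemma in_dyadicE (N d m : nat) : (0 < d)%N ->
  in_dyadic R N d m = (N < m * d <= 2 * N)%N.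
Proof.
move=> d_gt0; have d_gt0R : (0 : R) < d%:R by rewrite ltr0n.
by rewrite /in_dyadic ltr_pdivrMr // ler_pdivlMr // -!natrM ltr_nat ler_nat.
Qed.

(** The predicate bears on the multiple [m * d], so that a residue class and [predT] give the two
    counts occurring in [disc]. *)
Definition dyadic_count (N d : nat) (P : pred nat) : R :=
  \sum_(m < (2 * N).+1 | in_dyadic R N d m && P (m * d)%N) 1.

Lemma dyadic_count_size (N d : nat) (P : pred nat) : (0 < d)%N ->
  dyadic_count N d P =
    (size [seq m <- index_iota 0 (2 * N).+1 | (N < m * d <= 2 * N)%N & P (m * d)%N])%:R.
Proof.
move=> d_gt0; rewrite /dyadic_count.
rewrite -(big_mkord (fun m => in_dyadic R N d m && P (m * d)%N) (fun _ => 1)).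
rewrite -big_filter big_const_seq count_predT iter_addr_0.
by congr (_ *+ size _); apply: eq_filter => m; rewrite in_dyadicE.
Qed.

(** Double counting of the pairs [n = m * d]. The weight [G] is the sign of [disc] in the exact
    identity, and 1 when divisors are counted. *)
Lemma sum_over_multiples (N A B : nat) (P : pred nat) (G : nat -> R) :
  \sum_(N.+1 <= n < (2 * N).+1 | P n) \sum_(d <- divisors n | (A < d <= B)%N) G d =
  \sum_(A.+1 <= d < B.+1) G d * dyadic_count N d P.
Proof.
rewrite big_nat_cond (eq_bigr (fun n => \sum_(A.+1 <= d < B.+1 | (d %| n)%N) G d)); last first.
  move=> n /andP[/andP[n_gt _] _]; have n_gt0 : (0 < n)%N by exact: leq_ltn_trans n_gt.
  rewrite -big_filter -[RHS]big_filter; apply: perm_big.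
  apply: uniq_perm => [||d]; rewrite ?filter_uniq ?divisors_uniq ?iota_uniq //.
  by rewrite !mem_filter -dvdn_divisors // mem_index_iota ltnS andbC.
rewrite -big_nat_cond (exchange_big_dep predT) //=.
apply: eq_big_nat => d /andP[d_gt _].
have d_gt0 : (0 < d)%N by exact: leq_ltn_trans d_gt.
rewrite -big_filter big_const_seq count_predT iter_addr_0 dyadic_count_size //.
rewrite mulr_natr; congr (_ *+ _).
rewrite -[RHS](size_map (muln^~ d)); apply: perm_size; apply: uniq_perm => [||n].
- by rewrite filter_uniq ?iota_uniq.
- rewrite map_inj_uniq ?filter_uniq ?iota_uniq // => x y /eqP.
  by rewrite eqn_pmul2r // => /eqP.
rewrite mem_filter mem_index_iota; apply/andP/mapP.
  move=> [/andP[Pn /dvdnP[m def_n]] n_bd]; exists m => //.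
  rewrite ltnS in n_bd; rewrite mem_filter mem_index_iota -def_n Pn n_bd /= ltnS.
  by case/andP: n_bd => _; apply: leq_trans; rewrite def_n leq_pmulr.
move=> [m]; rewrite mem_filter => /andP[/andP[m_bd Pm] _] ->.
by rewrite Pm dvdn_mull // ltnS.
Qed.

Lemma fsieveE (N H Q q n : nat) :
  fsieve R N H Q q n =
  \sum_(d <- divisors n | (Q < d <= 2 * Q)%N) Num.sg (disc R N H q d).
Proof. by rewrite /fsieve [RHS]big_mkcond. Qed.

Lemma discE (N H q d : nat) :
  disc R N H q d =
  \sum_(1 <= a < H.+1) dyadic_count N d (fun n => n == a %[mod q])
  - H%:R / q%:R * dyadic_count N d predT.
Proof.
rewrite /disc big_split /= sumrN; congr (_ - _).
rewrite sumr_const_nat subn1 /= -[LHS]mulr_natl mulrA; congr (_ * _).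
by rewrite /dyadic_count; apply: eq_bigl => m; rewrite andbT.
Qed.

Lemma discrepancy_sum (N H Q q : nat) :
  \sum_(1 <= a < H.+1)
     \sum_(N.+1 <= n < (2 * N).+1 | (n == a %[mod q])%N) fsieve R N H Q q n
  - H%:R / q%:R * \sum_(N.+1 <= n < (2 * N).+1) fsieve R N H Q q n
  = \sum_(Q.+1 <= d < (2 * Q).+1) `|disc R N H q d|.
Proof.
have fsum P : \sum_(N.+1 <= n < (2 * N).+1 | P n) fsieve R N H Q q n =
    \sum_(Q.+1 <= d < (2 * Q).+1) Num.sg (disc R N H q d) * dyadic_count N d P.
  by rewrite -sum_over_multiples; apply: eq_bigr => n _; rewrite fsieveE.
under eq_bigr do rewrite fsum.
rewrite fsum exchange_big mulr_sumr -sumrB; apply: eq_bigr => d _ /=.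
rewrite -mulr_sumr mulrCA -mulrBr -discE.
by rewrite normrEsg.
Qed.

(* The sum over [a] is an integer: if it is positive the left-hand side is at
   most 0, and if it vanishes both sides are equal. *)
Lemma disc_lower_bound (N H q d : nat) : (0 < d)%N ->
  H%:R / q%:R * dyadic_count N d predT *
    (1 - \sum_(1 <= a < H.+1) dyadic_count N d (fun n => n == a %[mod q]))
  <= `|disc R N H q d|.
Proof.
move=> d_gt0; rewrite discE.
have [k ->] : exists k, \sum_(1 <= a < H.+1) dyadic_count N d (fun n => n == a %[mod q]) = k%:R.
  under eq_bigr do rewrite dyadic_count_size //.
  by rewrite -natr_sum; eexists.
have C_ge0 : 0 <= H%:R / q%:R * dyadic_count N d predT.
  by rewrite mulr_ge0 ?divr_ge0 // sumr_ge0.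
case: k => [|k]; first by rewrite subr0 mulr1 sub0r normrN ger0_norm.
apply: le_trans (normr_ge0 _); rewrite mulr_ge0_le0 // subr_le0 ler1n //.
Qed.

(** The count exceeds [N / d - 1], and [N / d >= 2] makes this at least [N / (2 * d)], hence at
    least [N / (4 * Q)]. *)
Lemma dyadic_count_lower_bound (N Q d : nat) :
  (0 < d <= 2 * Q)%N -> (4 * Q <= N)%N ->
  N%:R / (4 * Q)%:R <= dyadic_count N d predT.
Proof.
move=> /andP[d_gt0 d_le] Q_le; rewrite dyadic_count_size //.
have Q_gt0 : (0 < Q)%N by lia.
rewrite ler_pdivrMr ?ltr0n ?muln_gt0 // -natrM ler_nat.
set s := seq.filter _ _; have : (2 * N %/ d - N %/ d <= size s)%N.
  rewrite -[X in (X <= _)%N](size_iota (N %/ d).+1); apply: uniq_leq_size; first exact: iota_uniq.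
  move=> m; rewrite mem_iota mem_filter mem_index_iota /= andbT => m_bd.
  have m_gt : (N %/ d < m)%N by lia.
  have m_le : (m <= 2 * N %/ d)%N by lia.
  rewrite -ltn_divLR // m_gt -leq_divRL // m_le ltnS.
  exact: leq_trans m_le (leq_div _ _).
have := leq_trunc_div N d; have := ltn_ceil (2 * N) d_gt0.
move: (_ %/ _)%N (_ %/ _)%N (size s) => u v w; nia.
Qed.

(** Members of one class are told apart by their quotients by [q], which are at most [2 * N %/ q];
    the extra 1 is absorbed by [q <= N]. *)
Lemma residue_class_count (N q a : nat) : (0 < q <= N)%N ->
  (size [seq n <- index_iota N.+1 (2 * N).+1 | n == a %[mod q]] * q <= 3 * N)%N.
Proof.
move=> /andP[q_gt0 q_le]; set s := seq.filter _ _.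
have : (size s <= (2 * N %/ q).+1)%N.
  rewrite -(size_map (divn^~ q)) -[X in (_ <= X)%N](size_iota 0); apply: uniq_leq_size.
    rewrite map_inj_in_uniq ?filter_uniq ?iota_uniq // => x y.
    rewrite !mem_filter => /andP[/eqP xa _] /andP[/eqP ya _] xy.
    by rewrite (divn_eq x q) (divn_eq y q) xy xa ya.
  move=> x /mapP[n]; rewrite mem_filter mem_index_iota ltnS => /andP[_ /andP[_ n_le]] ->.
  by rewrite mem_iota /= add0n ltnS leq_div2r.
have := leq_trunc_div (2 * N) q; move: (_ %/ _)%N (size s) => u w; nia.
Qed.

(** The constant is [1/4 * 1/2]: each [d] contributes [H / q * (N / (4 * Q))] times [1 - A d], and
    these last factors add up to at least [Q / 2]. *)
Lemma discrepancy_lower_bound (delta : R) (N H Q q : nat) :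
  (Q < q <= 2 * Q)%N -> (q <= N)%N -> (4 * Q <= N)%N ->
  N%:R `^ (1 + delta) * H%:R <= Q%:R ^+ 2 ->
  (forall n, (0 < n <= 2 * N)%N -> 6 * (size (divisors n))%:R <= N%:R `^ delta) ->
  8^-1 * (N%:R * H%:R / q%:R) <= \sum_(Q.+1 <= d < (2 * Q).+1) `|disc R N H q d|.
Proof.
move=> /andP[Qq q_le] qN QN NHQ div_bd.
have Q_gt0 : (0 < Q)%N by lia.
have N_gt0 : (0 < N)%N by lia.
have Q_gt0R : (0 : R) < Q%:R by rewrite ltr0n.
have q_gt0R : (0 : R) < q%:R by rewrite ltr0n; lia.
have QqR : Q%:R <= q%:R :> R by rewrite ler_nat ltnW.
pose A d := \sum_(1 <= a < H.+1) dyadic_count N d (fun n => n == a %[mod q]).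
have A_ge0 d : 0 <= A d by apply: sumr_ge0 => a _; apply: sumr_ge0.
have disc_ge d : (Q.+1 <= d < (2 * Q).+1)%N ->
    H%:R / q%:R * (N%:R / (4 * Q)%:R) * (1 - A d) <= `|disc R N H q d|.
  move=> /andP[d_gt d_le]; have d_gt0 : (0 < d)%N by lia.
  have cnt_ge := @dyadic_count_lower_bound N Q d.
  (* For [A d > 1] the left-hand side is not positive; otherwise [1 - A d >= 0] and the count may be
     replaced by its lower bound. *)
  case: (lerP (A d) 1) => A_1; last first.
    apply: le_trans (normr_ge0 _); rewrite mulr_ge0_le0 //.
    by rewrite subr_le0 ltW.
  have := @disc_lower_bound N H q d d_gt0; rewrite -/(A d); apply: le_trans.
  rewrite ler_wpM2r ?subr_ge0 // ler_wpM2l ?divr_ge0 //.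
  by apply: cnt_ge => //; rewrite d_gt0.
(* Each of the [H] classes has at most [3 * N / q] members, each with at most [N ^ delta / 6]
   divisors: in all at most [Q ^ 2 / (2 * q) <= Q / 2]. *)
have A_sum : \sum_(Q.+1 <= d < (2 * Q).+1) A d <= Q%:R / 2.
  rewrite exchange_big /=.
  have A_a a : 6 * q%:R * \sum_(Q.+1 <= d < (2 * Q).+1) dyadic_count N d (fun n => n == a %[mod q])
      <= 3 * N%:R `^ (1 + delta).
    under eq_bigr do rewrite -[dyadic_count _ _ _]mul1r.
    rewrite -(sum_over_multiples N Q (2 * Q) (fun n => n == a %[mod q]) (fun=> 1)).
    rewrite powRD ?pnatr_eq0 ?implybE ?orbT -?lt0n ?N_gt0 ?orbT // powRr1 //.
    set S := \sum_(_ <= _ < _ | _) _.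
    have S_le : 6 * S <= \sum_(N.+1 <= n < (2 * N).+1 | n == a %[mod q]) N%:R `^ delta.
      rewrite mulr_sumr big_nat_cond [leRHS]big_nat_cond; apply: ler_sum => n /andP[n_bd _].
      apply: le_trans (div_bd n _); last by lia.
      by rewrite ler_wpM2l // big_const_seq iter_addr_0 ler_nat count_size.
    rewrite -big_filter big_const_seq count_predT iter_addr_0 -[leRHS]mulr_natl in S_le.
    have q_bd : (0 < q <= N)%N by rewrite qN andbT (leq_trans _ Qq).
    have := @residue_class_count N q a q_bd; rewrite -(ler_nat R) !natrM.
    move: (size _)%:R S_le => w S_le w_le.
    have P_ge0 := powR_ge0 (N%:R : R) delta.
    apply: (@le_trans _ _ (w * q%:R * N%:R `^ delta)); last first.
      by rewrite [leRHS]mulrA ler_wpM2r.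
    by rewrite mulrAC [leRHS]mulrAC ler_pM2r.
  rewrite -(ler_pM2l (_ : 0 < 6 * q%:R)) ?mulr_gt0 //.
  apply: (@le_trans _ _ (3 * Q%:R ^+ 2)); last by have := ler_wpM2r (ltW Q_gt0R) QqR; lra.
  apply: (@le_trans _ _ (3 * (N%:R `^ (1 + delta) * H%:R))); last by rewrite ler_wpM2l.
  rewrite mulr_sumr; apply: (@le_trans _ _ (\sum_(1 <= a < H.+1) 3 * N%:R `^ (1 + delta))).
    by apply: ler_sum.
  by rewrite sumr_const_nat subn1 /= -mulrnAr -[X in 3 * X]mulr_natr.
apply: le_trans (ler_sum_nat disc_ge).
rewrite -mulr_sumr sumrB sumr_const_nat.
have -> : ((2 * Q).+1 - Q.+1 = Q)%N by lia.
apply: (@le_trans _ _ (H%:R / q%:R * (N%:R / (4 * Q)%:R) * (Q%:R / 2))).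
  rewrite natrM le_eqVlt; apply/orP; left; apply/eqP; field.
  by rewrite ?gt_eqF.
rewrite ler_wpM2l ?mulr_ge0 ?divr_ge0 //; lra.
Qed.

(** With [k > 2 / delta], the [k]-th power of the right-hand side is at least [N ^ 2], while that of
    the left is at most [6 ^ k * C * 2 * N]; the threshold for [N] makes the latter at most
    [N ^ 2]. *)
Lemma divisor_bound_powR (delta : R) : 0 < delta ->
  exists N0, forall N n, (N0 <= N)%N -> (0 < n <= 2 * N)%N ->
    6 * (size (divisors n))%:R <= N%:R `^ delta.
Proof.
move=> delta_gt0.
have [k k_gt] : exists k : nat, 2 / delta < k%:R.
  by exists (Num.bound (2 / delta)); apply: archi_boundP; rewrite divr_ge0 // ltW.
have [C C_gt0 div_le] := divisor_bound k.
exists (6 ^ k * (C * 2))%N => N n N_ge /andP[n_gt0 n_le].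
have N_gt0 : (0 < N)%N by apply: leq_trans N_ge; rewrite !muln_gt0 expn_gt0 C_gt0.
have k_gt0 : (0 < k)%N by rewrite -(ltr_nat R); apply: le_lt_trans k_gt; rewrite divr_ge0 // ltW.
rewrite -(ler_pXn2r k_gt0) ?nnegrE ?mulr_ge0 ?powR_ge0 //.
rewrite -[leRHS]powR_mulrn ?powR_ge0 // -powRrM.
apply: (@le_trans _ _ (N%:R `^ 2)); last first.
  rewrite ler_powR ?ler1n // mulrC -ler_pdivrMr //; exact: ltW.
rewrite (@powR_mulrn _ _ 2) // -natrM -!natrX ler_nat expnMn.
apply: (@leq_trans (6 ^ k * (C * (2 * N)))).
  by rewrite leq_mul2l (leq_trans (div_le n n_gt0)) ?orbT // leq_mul2l n_le orbT.
by rewrite -mulnn !mulnA leq_mul2r -!mulnA N_ge orbT.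
Qed.
End Discrepancy.

(** * The sieve property, and the passage from asymptotic hypotheses to explicit inequalities *)

Theorem mainTheorem2 (R : realType) (delta : R) (delta_gt0 : 0 < delta) :
  (exists K : R -> R, forall N H Q q : nat,
      (0 < N)%N ->
      (Q < q <= 2 * Q)%N ->
      Num.sqrt (N%:R `^ (1 + delta) * H%:R) < Q%:R ->
      sieve_function K (2 * Q)%N (fsieve R N H Q q))
  /\
  (exists2 c : R, 0 < c &
    forall r s : nat -> R,
      r n @[n --> \oo] --> (0 : R) ->
      s n @[n --> \oo] --> (0 : R) ->
      \forall N \near \oo, forall H Q q : nat,
        (Q < q <= 2 * Q)%N ->
        H%:R / q%:R <= r N ->
        q%:R / N%:R <= s N ->
        Num.sqrt (N%:R `^ (1 + delta) * H%:R) < Q%:R ->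
        c * (N%:R * H%:R / q%:R) <=
        `| \sum_(1 <= a < H.+1)
              \sum_(N.+1 <= n < (2 * N).+1 | (n == a %[mod q])%N)
                 fsieve R N H Q q n
           - H%:R / q%:R *
             \sum_(N.+1 <= n < (2 * N).+1) fsieve R N H Q q n |).
Proof.
split.
  (* Signs are bounded by [1 <= d ^ eps], so the constant 1 serves all parameters at once. *)
  exists (fun=> 1) => N H Q q _ Qq _.
  have fE d : (0 < d)%N -> eratosthenes (fsieve R N H Q q) d = gfun R N H Q q d.
    exact: eratosthenes_sum.
  split=> [[|d] d_out|eps eps_gt0 d d_gt0].
  - (* [divisors 0] is [[:: 1]], so that the value at 0 is a multiple of [gfun 1]. *)
    rewrite /eratosthenes /dirichlet_conv big_seq1 /fsieve big_seq1 /gfun.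
    by case: ifP => [Q_lt1|_]; [lia | rewrite mul0r].
  - by rewrite fE // /gfun; case: ifP => // d_in; lia.
  rewrite fE // mul1r; apply: (@le_trans _ _ 1).
    by rewrite /gfun; case: ifP => _; rewrite ?normr0 // normr_sg lern1 leq_b1.
  by rewrite -[leLHS](powRr0 (d%:R : R)) ler_powR ?ler1n // ltW.
exists 8^-1 => // r s _ s0.
have [N0 div_bd] := divisor_bound_powR R delta delta_gt0.
(* From [q / N <= s N < 1/4] follows [4 * q <= N], hence [4 * Q <= N]. *)
have s_lt : \forall N \near \oo, s N < 4^-1 by apply: cvgr_lt s0 _ _.
near=> N => H Q q /andP[Qq q_le] _ qN_le NHQ.
have N_gt0 : (0 < N)%N by near: N; exists 1%N.
have N_ge : (N0 <= N)%N by near: N; exists N0.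
have qN : (4 * q <= N)%N.
  rewrite -(ler_nat R) natrM mulrC -ler_pdivlMr // -ler_pdivrMl ?ltr0n //.
  rewrite mulrC; apply: le_trans qN_le _; apply: ltW; near: N; exact: s_lt.
rewrite discrepancy_sum; apply: (@le_trans _ _ _ _ _ _ (ler_norm _)).
apply: (discrepancy_lower_bound R delta) => //; first by rewrite Qq.
- by lia.
- by lia.
- rewrite -[leLHS]sqr_sqrtr ?mulr_ge0 ?powR_ge0 //.
  by rewrite ler_pXn2r ?nnegrE ?sqrtr_ge0 // ltW.
by move=> n n_bd; apply: div_bd.
Unshelve. all: by end_near.
Qed.
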